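(* For every integer $n>0$, $$\det\bigl(s_{i+j-1}(u)\bigr)_{0\le i,j\le n-1}=\frac{U_n}{u}.$$
   Context: Let $a_k=\frac{1}{2k+1}\binom{3k}{k}$ for $k\ge 0$ and $U_n=\det(a_{i+j})_{0\le i,j\le n-1}$. Here $u$ is an arbitrary (nonzero) parameter, and $$s_n(u)=\sum_{k=0}^{n}\frac{k+1}{n+1}\binom{3n-k+1}{n-k}u^k\quad(n\ge 0),\qquad s_{-1}(u)=u^{-1}.$$ *)

(* Defs.v *)
From mathcomp Require Import all_boot all_order all_algebra.
Set Implicit Arguments.
Unset Strict Implicit.
Unset Printing Implicit Defensive.
Import GRing.Theory.
Local Open Scope ring_scope.

(* The quotients below are meaningful when F has characteristic 0. *)
Definition a (F : fieldType) (k : nat) : F :=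
  (2 * k + 1)%:R^-1 * 'C(3 * k, k)%:R.

Definition U (F : fieldType) (n : nat) : F :=
  \det (\matrix_(i < n, j < n) a F (i + j)).

(* Only the indices m >= -1 are meaningful; 0 is a junk value for m < -1. *)
Definition s (F : fieldType) (u : F) (m : int) : F :=
  match m with
  | Posz n => \sum_(0 <= k < n.+1)
      (k + 1)%:R / (n + 1)%:R * 'C(3 * n - k + 1, n - k)%:R * u ^+ k
  | Negz 0 => u^-1
  | Negz _.+1 => 0
  end.

(* Main.v *)
Require Import Defs.
From mathcomp Require Import all_boot all_order all_algebra.
From mathcomp Require Import ring zify.
Set Implicit Arguments.
Unset Strict Implicit.
Unset Printing Implicit Defensive.
Import GRing.Theory.
Local Open Scope ring_scope.

(** Let T be the power series with T = 1 + x T^3, whose coefficients are the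
numbers a_k.  The coefficient of x^m in T^r is the integer [ternary m r]
below, and s_n(u) is the coefficient of x^n in T^2 / (1 - u x T^2)
(lemma [scaled_s]).  Hence the sequence u s_{n-1}(u) has generating series
F_u = 1 / (1 - u x T^2), while T itself is F_1, because T = 1 + x T^3 says
that T (1 - x T^2) = 1.

The Hankel determinant of a series F = 1 / (1 - x H) depends on H in a simple
way: the Hankel matrix of F, multiplied by the unipotent Toeplitz matrix of
1 - x H, acquires (1, 0, ..., 0) as its first column, and the remaining minor
is the Hankel matrix of (H - H(0)) / x times the unipotent Toeplitz matrix of
F (lemma [det_hankel_shift]).  So the n x n Hankel determinant of F equals the
(n-1) x (n-1) Hankel determinant of (H - H(0)) / x.  For H = u T^2 the latter
is u^(n-1) times its value at u = 1, which is U_n.  Since the n x n Hankel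
matrix of F_u is u times the matrix of the s_{i+j-1}(u), comparing the powers
of u leaves U_n / u. *)

(** * Hankel determinants and reciprocal series *)

Section Hankel.

Variable R : comNzRingType.
Implicit Types f h p : nat -> R.

Definition hankel n f : 'M[R]_n := \matrix_(i, j) f (i + j)%N.

Definition toeplitz n p : 'M[R]_n :=
  \matrix_(i, j) if (j <= i)%N then p (i - j)%N else 0.

(** The coefficients of 1 - x H, for H the series with coefficients h. *)
Definition one_subX h k : R := if k is k'.+1 then - h k' else 1.

(** The sequence f has generating series F = 1 / (1 - x H), in the form
F = 1 + x H F. *)
Definition recip_series f h : Prop :=
  f 0%N = 1 /\ forall m, f m.+1 = \sum_(k < m.+1) h k * f (m - k)%N.

Lemma det_toeplitz n p : p 0%N = 1 -> \det (toeplitz n p) = 1.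
Proof.
move=> p0; rewrite det_trig.
  by rewrite big1 // => i _; rewrite mxE leqnn subnn.
by apply/is_trig_mxP => i j lt_ij; rewrite mxE leqNgt lt_ij.
Qed.

Lemma sum_toeplitz n p (A : nat -> R) (i : 'I_n) :
  \sum_(k < n) toeplitz n p i k * A k = \sum_(k < i.+1) p (i - k)%N * A k.
Proof.
rewrite (big_ord_widen n (fun k => p (i - k)%N * A k)) // [RHS]big_mkcond.
by apply: eq_bigr => k _; rewrite mxE ltnS; case: ifP; rewrite ?mul0r.
Qed.

(** The coefficient of degree i + 1 + j in (1 - x H) F vanishes. The left side
keeps of this convolution the terms with the first i + 2 coefficients of
1 - x H, so it equals minus the sum of the other terms. *)
Lemma sum_one_subX f h i j : recip_series f h ->
  \sum_(k < i.+2) one_subX h (i.+1 - k) * f (k + j)%N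
    = \sum_(l < j) h (i.+1 + l)%N * f (j.-1 - l)%N.
Proof.
move=> [_ fS]; rewrite big_ord_recr /= subnn /= mul1r addSn fS.
(* The full convolution for f (i + j + 1) splits at degree i: its lower part is
   cancelled, in reverse order, by the terms - h (i - k). *)
rewrite -addSn big_split_ord /= (reindex_inj rev_ord_inj) /= addrA -big_split /=.
rewrite big1 ?add0r.
  by apply: eq_bigr => l _; congr (_ * f _); have := ltn_ord l; lia.
move=> k _; have lt_ki := ltn_ord k.
rewrite subSS (_ : (i.+1 - (i - k) = k.+1)%N); last by lia.
rewrite (_ : (i - k + j = i + j - k)%N); last by lia.
by rewrite mulNr addNr.
Qed.

(** Multiply the Hankel matrix of F on the left by the Toeplitz matrix of
1 - x H. The first column becomes (1, 0, ..., 0), since F (1 - x H) = 1, and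
the complementary minor is again a product of a Hankel matrix with a
unipotent Toeplitz matrix. *)
Lemma det_hankel_shift n f h : recip_series f h ->
  \det (hankel n.+1 f) = \det (hankel n (fun k => h k.+1)).
Proof.
move=> fh; have [f0 _] := fh.
pose A := toeplitz n.+1 (one_subX h) *m hankel n.+1 f.
have AE i j : A i j = \sum_(k < i.+1) one_subX h (i - k) * f (k + j)%N.
  rewrite -(sum_toeplitz _ (fun k => f (k + j)%N)) mxE.
  by apply: eq_bigr => k _; rewrite [hankel _ _ _ _]mxE.
transitivity (\det A); first by rewrite det_mulmx det_toeplitz // mul1r.
rewrite (expand_det_col _ ord0) big_ord_recl big1 ?addr0; last first.
  by move=> i _; rewrite AE sum_one_subX // big_ord0 mul0r.
rewrite AE big_ord1 /= addn0 f0 !mul1r /cofactor expr0 mul1r.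
rewrite -[RHS]mulr1 -(det_toeplitz n f0) -[X in _ * X]det_tr -det_mulmx.
congr (\det _); apply/matrixP=> i j; rewrite 2![LHS]mxE AE sum_one_subX // mxE /=.
under [RHS]eq_bigr => k _ do rewrite mxE [_^T _ _]mxE mulrC.
rewrite (sum_toeplitz _ (fun k => h (i + k).+1)).
by apply: eq_bigr => l _; rewrite mulrC.
Qed.

End Hankel.

(** * Coefficients of the powers of T *)

Lemma sum_triangle (R : comNzRingType) (G : nat -> nat -> R) m :
  \sum_(k < m.+1) \sum_(l < (m - k).+1) G k l
    = \sum_(l < m.+1) \sum_(k < (m - l).+1) G k l.
Proof.
have widen (H : nat -> R) (k : 'I_m.+1) :
    \sum_(l < (m - k).+1) H l = \sum_(l < m.+1 | (k + l <= m)%N) H l.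
  rewrite (big_ord_widen m.+1 H) ?ltnS ?leq_subr //; apply: eq_bigl => l.
  by have := ltn_ord k; lia.
under eq_bigr => k _ do rewrite widen.
under [RHS]eq_bigr => l _ do rewrite (widen (G^~ l)).
rewrite (exchange_big_dep xpredT) //=.
by apply: eq_bigr => l _; apply: eq_bigl => k; rewrite addnC.
Qed.

Section Ternary.

Variable R : comNzRingType.

(** The coefficient of x^m in T^r, where T = 1 + x T^3. The usual formula
r / (3m + r) * binomial(3m + r, m) is rewritten as a difference of integers,
which gives it a meaning in every ring and at m = r = 0, and makes the
recurrence below an instance of Pascal's rule. *)
Definition ternary (m r : nat) : R :=
  if m is m'.+1 then
    'C(3 * m' + r + 2, m'.+1)%:R - 2%:R * 'C(3 * m' + r + 2, m')%:R
  else 1.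

(** The binomial formula for the coefficients, with r + 1 in the role of r and
without division. The factor 2m + r + 1 is the denominator 2k + 1 of a_k for
(m, r) = (k, 0), and twice the denominator n + 1 of s_n for
(m, r) = (n - k, 2k + 1). *)
Lemma ternaryE m r :
  (2 * m + r + 1)%:R * ternary m r.+1 = r.+1%:R * 'C(3 * m + r, m)%:R.
Proof.
case: m => [|m]; first by rewrite bin0 /= !muln0 !add0n addn1.
rewrite /= (_ : (3 * m + r.+1 + 2 = 3 * m.+1 + r)%N); last by lia.
have /(congr1 (fun b => b%:R : R)) := mul_bin_left (3 * m.+1 + r) m.
rewrite (_ : (3 * m.+1 + r - m = 2 * m.+1 + r + 1)%N) ?natrM; last by lia.
by rewrite mulrBr [in X in _ - X]mulrCA => <-; ring.
Qed.

Lemma ternary0 m : ternary m.+1 0 = 0.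
Proof.
rewrite /= addn0 -natrM; apply/eqP; rewrite subr_eq0; apply/eqP; congr _%:R.
apply/eqP; rewrite -(eqn_pmul2l (ltn0Sn m)) mul_bin_left mulnA; apply/eqP.
by congr (_ * _)%N; lia.
Qed.

(** The identity T^(r+1) = T^r + x T^(r+3). *)
Lemma ternaryS m r :
  ternary m.+1 r.+1 = ternary m.+1 r + ternary m r.+3.
Proof.
case: m => [|m]; first by rewrite /= muln0 !add0n !addn2 !bin1 !bin0; ring.
rewrite /= (_ : (3 * m.+1 + r.+1 + 2 = (3 * m.+1 + r + 2).+1)%N); last by lia.
rewrite (_ : (3 * m + r.+3 + 2 = 3 * m.+1 + r + 2)%N); last by lia.
by rewrite !binS !natrD; ring.
Qed.

(** The identity T^q T^r = T^(r+q), by induction on the degree and then on r: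
both sides satisfy the recurrence of [ternaryS] in r. *)
Lemma ternary_conv q m r :
  \sum_(k < m.+1) ternary k q * ternary (m - k) r = ternary m (r + q).
Proof.
elim: m r => [|m IHm] r; first by rewrite big_ord1 mul1r.
elim: r => [|r IHr].
  rewrite big_ord_recr /= subnn mulr1 big1 ?add0r // => k _.
  by rewrite subSn ?ternary0 ?mulr0 // -ltnS.
rewrite addSn ternaryS -IHr -!addSn -IHm [in LHS]big_ord_recr.
rewrite [in RHS]big_ord_recr /= subnn /= addrAC -big_split /=.
congr (_ + _); apply: eq_bigr => k _.
by rewrite subSn ?ternaryS ?mulrDr // -ltnS.
Qed.

(** The identity T = 1 / (1 - x T^2). *)
Lemma ternary_recip : recip_series (ternary^~ 1%N) (ternary^~ 2%N).
Proof. by split=> // m; rewrite ternary_conv ternaryS ternary0 add0r. Qed.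

(** The coefficient of x^m in 1 / (1 - u x T^2), expanded as a geometric
series. *)
Definition geom_ternary (u : R) m : R :=
  \sum_(k < m.+1) ternary (m - k) (2 * k) * u ^+ k.

Lemma geom_ternaryS u m :
  geom_ternary u m.+1
    = u * \sum_(k < m.+1) ternary (m - k) (2 * k).+2 * u ^+ k.
Proof.
rewrite /geom_ternary big_ord_recl subn0 muln0 ternary0 mul0r add0r mulr_sumr.
by apply: eq_bigr => k _; rewrite /= subSS mulnS exprS mulrCA.
Qed.

Lemma geom_ternary_recip u :
  recip_series (geom_ternary u) (fun k => u * ternary k 2).
Proof.
split=> [|m]; first by rewrite /geom_ternary big_ord1 mul1r.
rewrite geom_ternaryS /geom_ternary.
under [RHS]eq_bigr => l _ do rewrite -mulrA mulr_sumr.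
pose G k l : R := ternary l 2 * (ternary (m - l - k) (2 * k) * u ^+ k).
rewrite -mulr_sumr -(sum_triangle G); congr (_ * _); apply: eq_bigr => k _.
rewrite -addn2 -ternary_conv mulr_suml; apply: eq_bigr => l _.
by rewrite /G subnAC mulrA.
Qed.

End Ternary.

(** * Identification of the two sequences *)

Section CharacteristicZero.

Variables (F : fieldType) (charF0 : [pchar F] =i pred0).

Let natr_neq0 m : m.+1%:R != 0 :> F.
Proof. by rewrite ((pcharf0P F).1 charF0). Qed.

Lemma aE k : a F k = ternary F k 1.
Proof.
rewrite /a addn1; apply: (canLR (mulKf (natr_neq0 _))).
by have := ternaryE F k 0; rewrite !addn0 addn1 mul1r.
Qed.

(** Since s_n(u) is the coefficient of x^n in T^2 / (1 - u x T^2), the identity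
1 + u x T^2 / (1 - u x T^2) = 1 / (1 - u x T^2) yields the scaled and shifted
sequence; the value 1/u of s_{-1}(u) supplies the constant term. *)
Lemma scaled_s (u : F) m : u != 0 -> u * s u (m%:Z - 1) = geom_ternary u m.
Proof.
case: m => [|m] u0; first by rewrite /geom_ternary big_ord1 mul1r mulfV.
rewrite geom_ternaryS (_ : m.+1%:Z - 1 = m) /=; last by lia.
congr (_ * _); rewrite big_mkord; apply: eq_bigr => k _; congr (_ * _).
have le_km : (k <= m)%N by rewrite -ltnS.
apply: (mulfI (natr_neq0 (2 * m).+1)).
have := ternaryE F (m - k) (2 * k).+1.
rewrite (_ : (2 * (m - k) + (2 * k).+1 + 1 = (2 * m).+2)%N); last by lia.
rewrite (_ : (3 * (m - k) + (2 * k).+1 = 3 * m - k + 1)%N); last by lia.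
move=> ->; rewrite mulrA; congr (_ * _).
rewrite (_ : (2 * m).+2 = 2 * (m + 1))%N; last by lia.
rewrite (_ : (2 * k).+2 = 2 * (k + 1))%N; last by lia.
by rewrite !natrM -mulrA [X in _ * X]mulrC divfK // addn1.
Qed.

End CharacteristicZero.

Theorem mainTheorem2 (F : fieldType) (charF0 : [pchar F] =i pred0)
    (u : F) (u_neq0 : u != 0) (n : nat) (n_gt0 : (0 < n)%N) :
  \det (\matrix_(i < n, j < n) s u ((i + j)%:Z - 1)) = U F n / u.
Proof.
case: n n_gt0 => // n _; apply: (mulfI (expf_neq0 n.+1 u_neq0)).
(* Multiplying by u^(n+1) turns the matrix on the left into a Hankel matrix with
   leading entry 1. *)
rewrite -detZ.
have -> : u *: (\matrix_(i < n.+1, j < n.+1) s u ((i + j)%:Z - 1))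
    = hankel n.+1 (geom_ternary u).
  by apply/matrixP=> i j; rewrite !mxE scaled_s.
have -> : U F n.+1 = \det (hankel n.+1 (ternary F^~ 1%N)).
  by congr (\det _); apply/matrixP=> i j; rewrite !mxE aE.
rewrite (det_hankel_shift n (geom_ternary_recip u)).
rewrite (det_hankel_shift n (ternary_recip F)) exprSr mulrAC -mulrA mulfVK //.
by rewrite -detZ; congr (\det _); apply/matrixP=> i j; rewrite !mxE.
Qed.
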